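(* Let $f:\mathbb{R}^n\to\mathbb{R}$ be continuously differentiable on $\mathbb{R}^n$ and bounded below on $\mathbb{R}^n$, and suppose that its gradient $g=\nabla f$ is uniformly continuous on $\mathbb{R}^n$. Let $\{x_k\}_{k\ge 0}$ be the (infinite) sequence of iterates generated by the method GM_AOS (Reg) described in the context, with either $p=3$ or $p=4$, and let $g_k=\nabla f(x_k)$. Then $$\lim_{k\to\infty}\|g_k\|=0.$$
   Context: Notation: $\|\cdot\|$ is the Euclidean norm, $f_k=f(x_k)$, $g_k=\nabla f(x_k)$, $s_{k-1}=x_k-x_{k-1}$, $y_{k-1}=g_k-g_{k-1}$; $n$ is the dimension; $\bmod(k,n)$ is the residue of $k$ modulo $n$. Parameters: $x_0\in\mathbb{R}^n$, $0<\delta<1$, $0<c<1$, $0<c_1<c_2$, $0<\alpha_{\min}<\alpha_{\max}$, $\alpha_0^{(0)}>0$, $0<\sigma_{\min}<\sigma_{\max}$, $\xi_0\ge 1$, $0<\xi_1<0.1$, $0<\xi_2<1$, $\xi_3>0$, and a fixed $p\in\{3,4\}$. Auxiliary quantities (for $k\ge1$): $\alpha_k^{BB_1}=\|s_{k-1}\|^2/(s_{k-1}^Ty_{k-1})$, $\alpha_k^{BB_2}=(s_{k-1}^Ty_{k-1})/\|y_{k-1}\|^2$; $\mu_k=\left|\frac{2(f_{k-1}-f_k+g_k^Ts_{k-1})}{s_{k-1}^Ty_{k-1}}-1\right|$. Condition (Q): $\mu_k\le c_1$ or $\max\{\mu_k,\mu_{k-1}\}\le c_2$ (the second alternative is regarded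 as false if $\mu_{k-1}$ is undefined). Condition (G): $\|g_{k-1}\|^2/\|g_k\|^2\ge\xi_2$. When $s_{k-1}^Ty_{k-1}>0$: let $\overline r_k=\min\{\max\{3(g_k+g_{k-1})^Ts_{k-1}+6(f_{k-1}-f_k),\,-\xi_1 s_{k-1}^Ty_{k-1}\},\,\xi_1 s_{k-1}^Ty_{k-1}\}$, $\overline y_{k-1}=y_{k-1}+\frac{\overline r_k}{\|s_{k-1}\|^2}s_{k-1}$, $D_k=\xi_0\frac{y_{k-1}^Ty_{k-1}}{s_{k-1}^Ty_{k-1}}I$, and $$B_k=D_k-\frac{D_ks_{k-1}s_{k-1}^TD_k}{s_{k-1}^TD_ks_{k-1}}+\frac{\overline y_{k-1}\overline y_{k-1}^T}{s_{k-1}^T\overline y_{k-1}}.$$ Regularization parameter: $\sigma_k(p)=\max\{\min\{|\tilde\sigma_k(p)|,\sigma_{\max}\},\sigma_{\min}\}$, where $\tilde\sigma_k(p)=\frac{p\left(f_{k-1}-f_k+g_k^Ts_{k-1}-\frac12(s_{k-1}^Ty_{k-1}+\overline r_k)\right)}{\|s_{k-1}\|^p}$ if $s_{k-1}^Ty_{k-1}>0$, and $\tilde\sigma_k(p)=\frac{p\left(f_{k-1}-f_k+g_k^Ts_{k-1}-\frac12 s_{k-1}^Ty_{k-1}\right)}{\|s_{k-1}\|^p}$ if $s_{k-1}^Ty_{k-1}\le0$. Method GM_AOS (Reg): set $Q_0=1$, $C_0=f(x_0)$, and for $k=0,1,2,\dots$ do the following (the method is considered when it does not stop, i.e. $g_k\ne0$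 for all $k$, so that an infinite sequence is generated). (1) Initial stepsize. If $k=0$, use $\alpha_0^{(0)}$. If $k\ge1$, compute $\alpha_k$ as follows: (a) If $s_{k-1}^Ty_{k-1}>0$ and (Q) fails, $\alpha_k=\max\{\min\{\bar\alpha_k,\alpha_k^{BB_1}\},\alpha_k^{BB_2}\}$, where $\bar\alpha_k$ is the unique positive root $\alpha$ of $-\|g_k\|^2+\alpha\, g_k^TB_kg_k+\alpha^{p-1}\sigma_k(p)\|g_k\|^p=0$. (b) If $s_{k-1}^Ty_{k-1}>0$ and (Q) holds, $\alpha_k=\max\{\min\{\frac{g_k^Tg_k}{g_k^TB_kg_k},\alpha_k^{BB_1}\},\alpha_k^{BB_2}\}$. (c) If $s_{k-1}^Ty_{k-1}\le0$ and (G) holds, $\alpha_k$ is the unique positive root $\alpha$ of $-\|g_k\|^2+\alpha\frac{|s_{k-1}^Ty_{k-1}|}{\alpha_{k-1}^2}+\alpha^{p-1}\sigma_k(p)\|g_k\|^p=0$, where $\alpha_{k-1}$ is the final stepsize accepted at iteration $k-1$. (d) If $s_{k-1}^Ty_{k-1}\le0$ and (G) fails, $\alpha_k=\xi_3\alpha_{k-1}$, with $\alpha_{k-1}$ the final stepsize accepted at iteration $k-1$. Then set $\alpha_k^{(0)}=\max\{\min\{\alpha_k,\alpha_{\max}\},\alpha_{\min}\}$. (2) Line search. Start with $\alpha=\alpha_k^{(0)}$. While the condition $$f(x_k-\alpha g_k)\le C_k-\delta\alpha\|g_k\|^2$$ fails, replace $\alpha$ by $\overline\alpha$ if $\alpha>0.1\alpha_k^{(0)}$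 and $\overline\alpha\in[0.1\alpha_k^{(0)},0.9\alpha]$, and by $0.5\alpha$ otherwise; here $\overline\alpha=\frac{\alpha^2\|g_k\|^2}{2(f(x_k-\alpha g_k)-f_k+\alpha\|g_k\|^2)}$ is the minimizer of the quadratic interpolant of $t\mapsto f(x_k-tg_k)$ using its value and derivative at $t=0$ and its value at $t=\alpha$. When the condition holds, the final stepsize is $\alpha_k=\alpha$, and $x_{k+1}=x_k-\alpha_kg_k$. (3) Update $Q_{k+1}=\eta_kQ_k+1$ and $C_{k+1}=(\eta_kQ_kC_k+f(x_{k+1}))/Q_{k+1}$, where $\eta_k=c$ if $\bmod(k,n)=n-1$ and $\eta_k=1$ otherwise. *)

(* Defs.v *)
From mathcomp Require Import all_boot all_order all_algebra.
From mathcomp Require Import all_classical all_reals all_analysis.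
Import Order.TTheory GRing.Theory Num.Theory.
Import numFieldNormedType.Exports.

Set Implicit Arguments.
Unset Strict Implicit.
Unset Printing Implicit Defensive.

Local Open Scope classical_set_scope.
Local Open Scope ring_scope.

Section Euclidean.
Context {R : realType} {n : nat}.
Implicit Types u v x : 'cV[R]_n.

Definition dot u v : R := (u^T *m v) 0 0.

(* The library norm `|u| of a matrix is the sup norm, not this one.  Both
   induce the same uniform structure, so [differentiable], [continuous] and
   [unif_continuous] on 'cV[R]_n have their usual Euclidean meaning. *)
Definition enorm u : R := Num.sqrt (dot u u).

Definition grad (f : 'cV[R]_n -> R) x : 'cV[R]_n :=
  \col_i 'D_(delta_mx i 0) f x.

End Euclidean.

(* [alpha00] is the user-supplied first trial stepsize \alpha_0^{(0)}. *)
Record gm_params (R : realType) := GMParams {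
  delta : R;
  c : R;
  c1 : R;
  c2 : R;
  alpha_min : R;
  alpha_max : R;
  alpha00 : R;
  sigma_min : R;
  sigma_max : R;
  xi0 : R;
  xi1 : R;
  xi2 : R;
  xi3 : R }.

Record admissible (R : realType) (P : gm_params R) : Prop := Admissible {
  delta_itv : 0 < delta P < 1;
  c_itv : 0 < c P < 1;
  c1_gt0 : 0 < c1 P;
  c1_lt_c2 : c1 P < c2 P;
  alpha_min_gt0 : 0 < alpha_min P;
  alpha_min_lt_max : alpha_min P < alpha_max P;
  alpha00_gt0 : 0 < alpha00 P;
  sigma_min_gt0 : 0 < sigma_min P;
  sigma_min_lt_max : sigma_min P < sigma_max P;
  xi0_ge1 : 1 <= xi0 P;
  xi1_itv : 0 < xi1 P < 1 / 10;
  xi2_itv : 0 < xi2 P < 1;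
  xi3_gt0 : 0 < xi3 P }.

Section Method.
Context {R : realType} {n : nat}.
Variables (P : gm_params R) (p : nat) (f : 'cV[R]_n -> R).
(* [x] is the sequence of iterates and [alpha] the sequence of final (accepted)
   stepsizes. *)
Variables (x : nat -> 'cV[R]_n) (alpha : nat -> R).
Implicit Types (k : nat) (a : R).

Definition fk k : R := f (x k).
Definition gk k : 'cV[R]_n := grad f (x k).
Definition sk k : 'cV[R]_n := x k.+1 - x k.
Definition yk k : 'cV[R]_n := gk k.+1 - gk k.

(* From here to [aos_stepsize], the quantities with index k involve k.-1 and
   are only meaningful for 0 < k. *)

(* sy k = s_{k-1}^T y_{k-1} *)
Definition sy k : R := dot (sk k.-1) (yk k.-1).

Definition alphaBB1 k : R := enorm (sk k.-1) ^+ 2 / sy k.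
Definition alphaBB2 k : R := sy k / enorm (yk k.-1) ^+ 2.

Definition mu k : R :=
  `| 2 * (fk k.-1 - fk k + dot (gk k) (sk k.-1)) / sy k - 1 |.

(* mu_k is a quotient by s_{k-1}^T y_{k-1}, which may vanish. *)
Definition mu_defined k : bool := (0 < k)%N && (sy k != 0).

Definition condQ k : bool :=
  (mu k <= c1 P) ||
  (mu_defined k.-1 && (Num.max (mu k) (mu k.-1) <= c2 P)).

Definition condG k : bool :=
  xi2 P <= enorm (gk k.-1) ^+ 2 / enorm (gk k) ^+ 2.

Definition rbar k : R :=
  Num.min
    (Num.max (3 * dot (gk k + gk k.-1) (sk k.-1) + 6 * (fk k.-1 - fk k))
             (- xi1 P * sy k))
    (xi1 P * sy k).

(* ybar k = \overline y_{k-1} *)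
Definition ybar k : 'cV[R]_n :=
  yk k.-1 + (rbar k / enorm (sk k.-1) ^+ 2) *: sk k.-1.

Definition Dmx k : 'M[R]_n :=
  (xi0 P * (dot (yk k.-1) (yk k.-1) / sy k))%:M.

Definition Bmx k : 'M[R]_n :=
  let s := sk k.-1 in let D := Dmx k in
  D - (dot s (D *m s))^-1 *: (D *m s *m s^T *m D)
    + (dot s (ybar k))^-1 *: (ybar k *m (ybar k)^T).

Definition sigma_tilde k : R :=
  let d := fk k.-1 - fk k + dot (gk k) (sk k.-1) in
  let q := if 0 < sy k then sy k + rbar k else sy k in
  p%:R * (d - 1 / 2 * q) / enorm (sk k.-1) ^+ p.

Definition sigma k : R :=
  Num.max (Num.min `|sigma_tilde k| (sigma_max P)) (sigma_min P).

(* [a] is the unique positive root of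
   -||g_k||^2 + a * b + a^(p-1) * sigma_k(p) * ||g_k||^p = 0. *)
Definition reg_root k (b a : R) : Prop :=
  unique (fun t : R => 0 < t /\
    - enorm (gk k) ^+ 2 + t * b + t ^+ p.-1 * sigma k * enorm (gk k) ^+ p = 0)
    a.

(* The stepsize of step (1), before it is projected on [alpha_min, alpha_max]. *)
Definition aos_stepsize k a : Prop :=
  let g := gk k in
  let gBg := dot g (Bmx k *m g) in
  if 0 < sy k then
    if condQ k then
      a = Num.max (Num.min (dot g g / gBg) (alphaBB1 k)) (alphaBB2 k)
    else
      exists2 abar : R, reg_root k gBg abar
        & a = Num.max (Num.min abar (alphaBB1 k)) (alphaBB2 k)
  else
    if condG k then reg_root k (`|sy k| / alpha k.-1 ^+ 2) a
    else a = xi3 P * alpha k.-1.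

(* [a0] is the first trial stepsize \alpha_k^{(0)}. *)
Definition init_stepsize k (a0 : R) : Prop :=
  if k == 0%N then a0 = alpha00 P
  else exists2 a : R, aos_stepsize k a
         & a0 = Num.max (Num.min a (alpha_max P)) (alpha_min P).

Definition eta k : R := if (k %% n == n.-1)%N then c P else 1.

Fixpoint Qk k : R := if k is j.+1 then eta j * Qk j + 1 else 1.

Fixpoint Ck k : R :=
  if k is j.+1 then (eta j * Qk j * Ck j + fk j.+1) / Qk j.+1 else fk 0.

Definition armijo k a : bool :=
  f (x k - a *: gk k) <= Ck k - delta P * a * enorm (gk k) ^+ 2.

Definition interp_min k a : R :=
  a ^+ 2 * enorm (gk k) ^+ 2 /
    (2 * (f (x k - a *: gk k) - fk k + a * enorm (gk k) ^+ 2)).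

Definition next_trial k (a0 a : R) : R :=
  let b := interp_min k a in
  if (1 / 10 * a0 < a) && (1 / 10 * a0 <= b <= 9 / 10 * a) then b
  else 1 / 2 * a.

Definition line_search k (a0 a : R) : Prop :=
  exists m : nat,
    [/\ a = iter m (next_trial k a0) a0,
        forall j, (j < m)%N -> ~~ armijo k (iter j (next_trial k a0) a0)
      & armijo k a].

Definition gm_step k : Prop :=
  [/\ gk k != 0,
      exists2 a0 : R, init_stepsize k a0 & line_search k a0 (alpha k)
    & x k.+1 = x k - alpha k *: gk k].

End Method.

(* [x] is an infinite sequence of iterates generated by GM_AOS (Reg). *)
Definition GM_AOS_Reg (R : realType) (n : nat) (P : gm_params R) (p : nat)
    (f : 'cV[R]_n -> R) (x0 : 'cV[R]_n) (x : nat -> 'cV[R]_n) : Prop :=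
  x 0%N = x0 /\
  exists alpha : nat -> R, forall k, gm_step P p f x alpha k.

(* Main.v *)
Require Import Defs.
From mathcomp Require Import all_boot all_order all_algebra.
From mathcomp Require Import all_classical all_reals all_analysis.
From mathcomp Require Import ring lra.
Import Order.TTheory GRing.Theory Num.Theory.
Import numFieldNormedType.Exports.

Local Open Scope classical_set_scope.
Local Open Scope ring_scope.

(** The limit comes from the line search: the projection on
    [alpha_min, alpha_max] keeps the first trial stepsizes above the fixed
    positive number [Num.min (alpha00 P) (alpha_min P)], and from there on the
    argument is the classical one for nonmonotone backtracking along the gradient.

    Write g_k for the gradient at x_k and alpha_k for the accepted stepsize.

    - Vanishing decrease.  Resetting the weight eta to c < 1 once every n
      iterations keeps Q_k bounded ([Qk_le]).  Since
      Q_{k+1} (C_k - C_{k+1}) = C_k - f_{k+1} ([Ck_descent]), the acceptance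
      test makes C_k nonincreasing, and its decrease is at least a fixed multiple
      of alpha_k ||g_k||^2.  As C_k is an average of values of f, it is bounded
      below, hence convergent, and alpha_k ||g_k||^2 tends to 0
      ([decrease_cvg0]).

    - Stepsizes are not too short.  Backtracking never goes below a tenth of the
      first trial, except by a halving; so either alpha_k is at least a fixed
      positive number or 2 alpha_k was rejected ([line_search_lower]).  In the
      second case f_k <= C_k turns the rejection into a failure of the monotone
      Armijo test, and the mean value theorem gives a point on the segment from
      x_k to x_k - 2 alpha_k g_k at which the gradient differs from g_k by a
      fixed fraction of ||g_k||.  If ||g_k|| >= e, uniform continuity then forces
      that segment to have length at least some d > 0 depending only on e
      ([long_rejected_step]).

    So alpha_k ||g_k||^2 stays above a positive constant along all k with
    ||g_k|| >= e, and there can be only finitely many of these.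

    Uniform continuity refers to the sup norm | |, so the estimates between
    gradients are carried out in it; |u|^2 <= u.u <= n |u|^2 costs only
    constants. *)

(** * Euclidean product and sup norm *)

Lemma dotE {R : realType} {n : nat} (u v : 'cV[R]_n) :
  dot u v = \sum_i u i 0 * v i 0.
Proof. by rewrite /dot mxE; apply: eq_bigr => i _; rewrite mxE. Qed.

Lemma dotBl {R : realType} {n : nat} (u v w : 'cV[R]_n) :
  dot (u - v) w = dot u w - dot v w.
Proof.
by rewrite !dotE -sumrB; apply: eq_bigr => i _; rewrite !mxE mulrBl.
Qed.

Lemma dotNr {R : realType} {n : nat} (u v : 'cV[R]_n) :
  dot u (- v) = - dot u v.
Proof. by rewrite !dotE -sumrN; apply: eq_bigr => i _; rewrite mxE mulrN. Qed.

Lemma dot_ge0 {R : realType} {n : nat} (u : 'cV[R]_n) : 0 <= dot u u.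
Proof. by rewrite dotE; apply: sumr_ge0 => i _; rewrite -expr2 sqr_ge0. Qed.

Lemma sqr_enorm {R : realType} {n : nat} (u : 'cV[R]_n) :
  enorm u ^+ 2 = dot u u.
Proof. by rewrite sqr_sqrtr ?dot_ge0. Qed.

Lemma ler_coord_norm {R : realType} {n : nat} (u : 'cV[R]_n) i :
  `|u i 0| <= `|u|.
Proof.
rewrite [leRHS]/Num.Def.normr /= mx_normrE.
by apply/bigmax_geP; right => /=; exists (i, 0).
Qed.

Lemma ler_norm_dot {R : realType} {n : nat} (u v : 'cV[R]_n) :
  `|dot u v| <= n%:R * (`|u| * `|v|).
Proof.
rewrite dotE (le_trans (ler_norm_sum _ _ _))//.
rewrite (le_trans (y := \sum_(i < n) `|u| * `|v|))//.
  by apply: ler_sum => i _; rewrite normrM ler_pM ?ler_coord_norm.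
by rewrite sumr_const card_ord mulr_natl.
Qed.

Lemma sqr_norm_le_dot {R : realType} {n : nat} (u : 'cV[R]_n) :
  `|u| ^+ 2 <= dot u u.
Proof.
have [->|u0] := eqVneq `|u| 0; first by rewrite expr0n dot_ge0.
have [[i j] /= uij] := mx_norm_neq0 u0.
rewrite [`|u|]uij (ord1 j) real_normK ?num_real//.
rewrite dotE (bigD1 i)//= expr2 lerDl.
by apply: sumr_ge0 => k _; rewrite -expr2 sqr_ge0.
Qed.

(** * Calculus along a line *)

Lemma derive_grad {R : realType} {n : nat} (f : 'cV[R]_n -> R) z v :
  differentiable f z -> 'D_v f z = dot (grad f z) v.
Proof.
move=> df; rewrite deriveE// dotE.
rewrite [in LHS](matrix_sum_delta v) linear_sum/=; apply: eq_bigr => i _.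
by rewrite big_ord1 linearZ/= mxE deriveE// mulrC.
Qed.

(** The difference quotients of the restriction to the line are literally those
    of the directional derivative, so the two derivatives agree by definition. *)
Lemma is_derive_line {R : realType} {n : nat} (f : 'cV[R]_n -> R) z v (t : R) :
  differentiable f (z + t *: v) ->
  is_derive t 1 (fun s => f (z + s *: v)) (dot (grad f (z + t *: v)) v).
Proof.
move=> df.
have quotE : (fun h : R => h^-1 *: (((fun s => f (z + s *: v)) \o shift t) (h *: 1)
    - f (z + t *: v))) =
  (fun h : R => h^-1 *: ((f \o shift (z + t *: v)) (h *: v) - f (z + t *: v))).
  apply/funext => h /=; congr (_ *: (f _ - _)).
  by rewrite [h *: 1]mulr1 scalerDl addrCA.
split; first by rewrite /derivable quotE; exact: diff_derivable.
by rewrite -derive_grad// /derive quotE.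
Qed.

Lemma line_MVT {R : realType} {n : nat} (f : 'cV[R]_n -> R) z v (a : R) :
  (forall y, differentiable f y) -> 0 < a ->
  exists2 t, 0 < t < a &
    f (z + a *: v) - f z = dot (grad f (z + t *: v)) v * a.
Proof.
move=> df a0.
have dh (t : R) : is_derive t 1 (fun s => f (z + s *: v)) (dot (grad f (z + t *: v)) v).
  exact: is_derive_line.
have [|t] := MVT (f := fun s => f (z + s *: v)) a0 (fun t _ => dh t).
  apply: derivable_within_continuous => t _; exact: ex_derive.
rewrite in_itv/= subr0 scale0r addr0; by exists t.
Qed.

Lemma unif_continuous_norm {R : realType} {V W : normedModType R} {g : V -> W} :
  unif_continuous g -> forall e : R, 0 < e ->
  exists2 d, 0 < d & forall u v, `|u - v| < d -> `|g u - g v| < e.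
Proof.
move=> gu e e0.
have := gu [set xy | ball xy.1 e xy.2].
rewrite -!entourage_ballE => -[|d /= d0 dg]; first by exists e.
exists d => // u v uv; have := dg (u, v); rewrite /= -!ball_normE /=; exact.
Qed.

(** * The nonmonotone reference values *)

Lemma Qk_ge1 {R : realType} (n : nat) (P : gm_params R) k :
  0 < c P < 1 -> 1 <= @Qk R n P k.
Proof.
move=> /andP[c0 c1]; elim: k => [//|k ih] /=.
by rewrite lerDr mulr_ge0 ?(le_trans _ ih)// /eta; case: ifP => // _; exact: ltW.
Qed.

(** Within a cycle of n iterations Q grows by 1 at each step, and the cycle ends
    with q |-> c q + 1.  The bound A at the start of a cycle is reproduced when
    c (A + n - 1) + 1 <= A, which holds for A = n / (1 - c). *)
Lemma Qk_le {R : realType} (n : nat) (P : gm_params R) k :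
  (0 < n)%N -> 0 < c P < 1 ->
  @Qk R n P k <= n%:R / (1 - c P) + (k %% n)%:R.
Proof.
move=> n0 /andP[c0 c1].
set A := n%:R / (1 - c P).
have cA : A * (1 - c P) = n%:R by rewrite /A divfK// subr_eq0 gt_eqF.
have n1 : (1 : R) <= n%:R by rewrite ler1n.
have nE : n%:R = n.-1%:R + 1 :> R by rewrite natr1 prednK.
elim: k => [|k ih] /=.
  by rewrite mod0n addr0; nra.
rewrite /eta; case: ifPn => [/eqP kn|kn].
  have -> : (k.+1 %% n = 0)%N by rewrite -addn1 -modnDml kn addn1 prednK ?modnn.
  rewrite kn in ih; rewrite addr0.
  have : c P * @Qk R n P k <= c P * (A + n.-1%:R) by rewrite ler_pM2l.
  have := ler0n R n.-1; nra.
have -> : (k.+1 %% n = (k %% n).+1)%N.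
  have kltn := ltn_pmod k n0.
  by rewrite -addn1 -modnDml addn1 modn_small// -ltn_predRL ltn_neqAle kn -ltnS prednK.
by rewrite mul1r -natr1 addrA lerD2r.
Qed.

(** C_{k+1} is the average of C_k and f_{k+1} with weights eta_k Q_k and 1, so it
    covers the fraction 1 / Q_{k+1} of the way from C_k to f_{k+1}. *)
Lemma Ck_descent {R : realType} {n : nat} (P : gm_params R)
    (f : 'cV[R]_n -> R) (x : nat -> 'cV[R]_n) k :
  0 < c P < 1 ->
  @Qk R n P k.+1 * (Ck P f x k - Ck P f x k.+1) = Ck P f x k - fk f x k.+1.
Proof.
move=> cP; have Q0 : @Qk R n P k.+1 != 0 by rewrite gt_eqF//
  (lt_le_trans _ (Qk_ge1 n P k.+1 cP)).
by rewrite mulrBr [Ck P f x k.+1]/= mulrCA divff// /=; ring.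
Qed.

Lemma Ck_ge_lbound {R : realType} {n : nat} {P : gm_params R}
    {f : 'cV[R]_n -> R} {x : nat -> 'cV[R]_n} {L : R} {k} :
  0 < c P < 1 -> (forall z, L <= f z) -> L <= Ck P f x k.
Proof.
move=> cP fL; elim: k => [|k ih]; first exact: fL.
have Q1 := Qk_ge1 n P k.+1 cP.
have Qk1 := Qk_ge1 n P k cP.
rewrite [leRHS]/= ler_pdivlMr ?(lt_le_trans _ Q1)//= mulrDr mulr1 lerD ?fL//.
rewrite mulrC ler_wpM2l// mulr_ge0 ?(le_trans _ Qk1)// /eta.
by case: ifP => // _; case/andP: cP => /ltW.
Qed.

(** An average of C_j and f_{j+1} is at least f_{j+1} as soon as
    f_{j+1} <= C_j. *)
Lemma fk_le_Ck {R : realType} {n : nat} {P : gm_params R}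
    {f : 'cV[R]_n -> R} {x : nat -> 'cV[R]_n} {k} :
  0 < c P < 1 -> (forall j, fk f x j.+1 <= Ck P f x j) -> fk f x k <= Ck P f x k.
Proof.
move=> cP fC; case: k => [//|k].
have Q1 := Qk_ge1 n P k.+1 cP.
have Qk1 := Qk_ge1 n P k cP.
rewrite [leRHS]/= ler_pdivlMr ?(lt_le_trans _ Q1)//= mulrDr mulr1 lerD2r.
rewrite mulrC ler_wpM2l// mulr_ge0 ?(le_trans _ Qk1)// /eta.
by case: ifP => // _; case/andP: cP => /ltW.
Qed.

(** The amounts w_k by which f_{k+1} falls below C_k are dominated by a constant
    times C_k - C_{k+1}, the increments of a convergent sequence. *)
Lemma decrease_cvg0 {R : realType} {n : nat} {P : gm_params R}
    {f : 'cV[R]_n -> R} {x : nat -> 'cV[R]_n} {w : nat -> R} :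
  (0 < n)%N -> 0 < c P < 1 -> has_lbound (range f) ->
  (forall k, 0 <= w k) -> (forall k, fk f x k.+1 <= Ck P f x k - w k) ->
  w k @[k --> \oo] --> (0 : R).
Proof.
move=> n0 cP [L fL] w0 fw.
have CQ k := Ck_descent P f x k cP.
have Q1 k := Qk_ge1 n P k cP.
have Cdecr : {homo Ck P f x : k m / (k <= m)%N >-> m <= k}.
  apply/nonincreasing_seqP => k.
  rewrite -subr_ge0 -(pmulr_rge0 _ (lt_le_trans ltr01 (Q1 k.+1))) CQ.
  by have := fw k; have := w0 k; lra.
have Ccvg : cvgn (Ck P f x).
  apply: nonincreasing_is_cvgn => //; exists L => _ [k _ <-].
  by apply: Ck_ge_lbound => // z; apply: fL; exists z.
pose M := n%:R / (1 - c P) + n%:R.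
have wM k : w k <= M * (Ck P f x k - Ck P f x k.+1).
  rewrite (le_trans (y := Ck P f x k - fk f x k.+1))//.
    by have := fw k; lra.
  rewrite -CQ ler_wpM2r ?subr_ge0 ?Cdecr//.
  rewrite (le_trans (Qk_le _ _ _ n0 cP))// lerD2l ler_nat.
  by rewrite ltnW// ltn_pmod.
apply: (@squeeze_cvgr _ _ _ _ (cst 0) (fun k => M * (Ck P f x k - Ck P f x k.+1))).
- by near=> k; rewrite w0 wM.
- exact: cvg_cst.
- rewrite -[X in _ --> X](mulr0 M) -(subrr (limn (Ck P f x))).
  apply: cvgMl_tmp; apply: cvgB; first exact: Ccvg.
  by rewrite (cvg_shiftS (Ck P f x)).
Unshelve. all: by end_near. Qed.

(** * Length of the accepted step *)

(** An interpolated trial is only used when it is at least a tenth of the first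
    one; any other trial after the first is half of a rejected one. *)
Lemma line_search_lower {R : realType} {n : nat} {P : gm_params R}
    {f : 'cV[R]_n -> R} {x : nat -> 'cV[R]_n} {k} {a0 a : R} :
  0 < a0 -> line_search P f x k a0 a ->
  0 < a /\ (1 / 10 * a0 <= a \/ ~~ armijo P f x k (2 * a)).
Proof.
move=> a0_gt0 [m [-> rej _]].
elim: m rej => [|m ih] rej /=; first by split => //; left; lra.
have [a_gt0 _] := ih (fun j jm => rej j (ltnW jm)).
rewrite /next_trial; case: ifP => [/and3P[_ b_ge _]|_].
  by split; [lra|left].
split; first lra.
right; rewrite (_ : 2 * _ = iter m (next_trial f x k a0) a0) ?rej//; lra.
Qed.

Lemma init_stepsize_lower {R : realType} {n : nat} {P : gm_params R} {p : nat}
    {f : 'cV[R]_n -> R} {x : nat -> 'cV[R]_n} {alpha : nat -> R} {k} {a0 : R} :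
  init_stepsize P p f x alpha k a0 -> Num.min (alpha00 P) (alpha_min P) <= a0.
Proof.
rewrite /init_stepsize; case: ifP => [_ ->|_ [a _ ->]].
  by rewrite ge_min; apply/orP; left.
by rewrite ge_min !le_max; apply/orP; right; apply/orP; right.
Qed.

(** If the step a was too short for the gradient g to change by much on the
    segment, f would decrease along it at a rate above dlt ||g||^2 and the step
    would pass the Armijo test.  The factor n in the hypothesis pays for bounding
    a Euclidean product by sup norms. *)
Lemma long_rejected_step {R : realType} {n : nat} {f : 'cV[R]_n -> R}
    {z : 'cV[R]_n} {dlt a e d : R} :
  (forall y, differentiable f y) -> dlt < 1 -> 0 < a ->
  (forall u v, `|u - v| < d -> n%:R * `|grad f u - grad f v| < (1 - dlt) * e) ->
  e <= `|grad f z| -> 0 < e ->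
  f z - dlt * a * enorm (grad f z) ^+ 2 < f (z - a *: grad f z) ->
  d <= a * `|grad f z|.
Proof.
move=> df dlt1 a0 gd ez e0; rewrite sqr_enorm; set g := grad f z => fa.
have [t /andP[t0 ta]] := line_MVT f z (- g) a df a0.
rewrite !scalerN dotNr => fE.
rewrite leNgt; apply/negP => agd.
have uv : `|z - (z - t *: g)| < d.
  by rewrite opprB addrCA subrr addr0 normrZ gtr0_norm//
    (le_lt_trans _ agd)// ler_wpM2r// ltW.
have := gd _ _ uv; rewrite -/g; set g' := grad f _ in fE *.
apply/negP; rewrite -leNgt.
have g_gt0 : 0 < `|g| by exact: lt_le_trans ez.
rewrite -(ler_pM2r g_gt0).
(* The mean slope (f (z - a g) - f z) / a = - g'.g exceeds - dlt g.g. *)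
have : (1 - dlt) * dot g g <= dot (g - g') g.
  rewrite dotBl -(ler_pM2r a0); rewrite -/g' in fE; nra.
move=> /le_trans /(_ (ler_norm _)) /le_trans /(_ (ler_norm_dot _ _)).
rewrite mulrA; apply: le_trans.
rewrite -mulrA ler_pM2l ?subr_gt0// (le_trans _ (sqr_norm_le_dot _))//.
by rewrite expr2 ler_wpM2r.
Qed.

Lemma enorm_le_norm {R : realType} {n : nat} (u : 'cV[R]_n) :
  enorm u <= n%:R * `|u|.
Proof.
rewrite -(@ler_pXn2r _ 2) ?nnegrE ?mulr_ge0 ?sqrtr_ge0// sqr_enorm.
rewrite (le_trans (ler_norm _))// (le_trans (ler_norm_dot _ _))//.
rewrite -expr2 exprMn ler_wpM2r// -natrX ler_nat.
by case: n {u} => // n; rewrite leq_pmulr.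
Qed.

Theorem theorem4p1 (R : realType) (n : nat) (n_gt0 : (0 < n)%N)
    (P : gm_params R) (P_ok : admissible P)
    (p : nat) (p_34 : p = 3%N \/ p = 4%N)
    (f : 'cV[R]_n -> R)
    (f_diff : forall z : 'cV[R]_n, differentiable f z)
    (gradf_cont : continuous (grad f))
    (f_lb : has_lbound (range f))
    (gradf_ucont : unif_continuous (grad f))
    (x0 : 'cV[R]_n) (x : nat -> 'cV[R]_n)
    (x_gen : GM_AOS_Reg P p f x0 x) :
  enorm (grad f (x k)) @[k --> \oo] --> (0 : R).
Proof.
have [_ [alpha step]] := x_gen.
have cP := c_itv P_ok.
have /andP[dlt0 dlt1] := delta_itv P_ok.
have amin_gt0 := alpha_min_gt0 P_ok.
have a00_gt0 := alpha00_gt0 P_ok.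
pose amin := Num.min (alpha00 P) (alpha_min P).
have amin0 : 0 < amin by rewrite lt_min a00_gt0.
pose E k := enorm (gk f x k).
have ls k : [/\ 0 < alpha k,
    1 / 10 * amin <= alpha k \/ ~~ armijo P f x k (2 * alpha k)
    & armijo P f x k (alpha k)].
  have [_ [a0 /init_stepsize_lower a0ge lsk] _] := step k.
  have a0_gt0 := lt_le_trans amin0 a0ge.
  have [a_gt0 a_ge] := line_search_lower a0_gt0 lsk.
  split => //; last by case: lsk => m [].
  by case: a_ge => [a_ge|]; [left; rewrite -/amin in a0ge; lra|right].
have decr k : fk f x k.+1 <= Ck P f x k - delta P * alpha k * E k ^+ 2.
  by have [_ _ ar] := ls k; rewrite /fk; have [_ _ ->] := step k.
have w_ge0 k : 0 <= delta P * alpha k * E k ^+ 2.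
  by have [a_gt0 _ _] := ls k; rewrite mulr_ge0 ?sqr_ge0// ltW// mulr_gt0.
have w_cvg := decrease_cvg0 n_gt0 cP f_lb w_ge0 decr.
have fC k : fk f x k <= Ck P f x k.
  by apply: fk_le_Ck => // j; rewrite (le_trans (decr j))// gerBl.
have nR : (0 : R) < n%:R by rewrite ltr0n.
have g_small (e : R) : 0 < e -> \forall k \near \oo, `|gk f x k| < e.
  move=> e0.
  have e'0 : 0 < (1 - delta P) * e / n%:R by rewrite divr_gt0 ?mulr_gt0 ?subr_gt0.
  have [d d0 gd] := unif_continuous_norm gradf_ucont _ e'0.
  (* Lower bound for delta alpha_k ||g_k||^2 when |g_k| >= e: the two terms
     correspond to a step above a tenth of the first trial and to a step obtained
     by halving a rejected one. *)
  pose th := delta P * Num.min (1 / 10 * amin * e ^+ 2) (d / 2 * e).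
  have th0 : 0 < th.
    by rewrite mulr_gt0// lt_min !mulr_gt0 ?exprn_gt0// divr_gt0.
  have /cvgrPdist_lt /(_ _ th0) := w_cvg.
  apply: filterS => k; rewrite sub0r normrN ger0_norm ?w_ge0// => wth.
  rewrite ltNge; apply/negP => eg.
  move: wth; apply/negP; rewrite -leNgt /th -[leRHS]mulrA ler_pM2l//.
  have [a_gt0 a_ge _] := ls k.
  rewrite (le_trans (y := alpha k * `|gk f x k| ^+ 2))//; last first.
    by rewrite ler_pM2l// /E sqr_enorm sqr_norm_le_dot.
  rewrite ge_min; case: a_ge => [a_ge|rej]; apply/orP; [left|right].
    apply: ler_pM => //; [by rewrite mulr_ge0 ?(ltW amin0)|exact: sqr_ge0|].
    by rewrite ler_pXn2r ?nnegrE ?(ltW e0).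
  have ad : d <= 2 * alpha k * `|gk f x k|.
    apply: (long_rejected_step (dlt := delta P) (e := e)) => //.
    - by rewrite mulr_gt0.
    - by move=> u v /gd; rewrite ltr_pdivlMr// mulrC.
    - move: rej; rewrite /armijo -ltNge; apply: le_lt_trans.
      by rewrite lerD2r fC.
  by rewrite expr2 mulrA; apply: ler_pM => //; lra.
apply/cvgrPdist_lt => e e0.
have := g_small (e / n%:R) (divr_gt0 e0 nR); apply: filterS => k gke.
rewrite sub0r normrN ger0_norm ?sqrtr_ge0//.
by rewrite (le_lt_trans (enorm_le_norm _))// mulrC -ltr_pdivlMr.
Qed.
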